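(* Let $r\geqslant 5$ be an integer and let $D$ be any Dejean word over an alphabet of size $r$. Then the cut number of $D$ satisfies $\mu(D)\geqslant r$.
   Context: Words are finite sequences of letters; $|W|$ denotes the length of a word $W$. A factor of a word $W$ is a word $F$ such that $W=AFB$ for some (possibly empty) words $A,B$. If $W=w_1w_2\cdots w_n$ and $F=w_iw_{i+1}\cdots w_{i+m-1}$, we say that $F$ occurs in $W$ at position $i$. The distance between two different occurrences of $F$ in $W$, at positions $i<j$, is $j-i$. For $r\geqslant 5$, a Dejean word over an alphabet of size $r$ is a word $D$ over that alphabet such that for every factor $F$ of $D$, any two different occurrences of $F$ in $D$ are at distance at least $(r-1)|F|$. A tangram is a word in which every letter occurs an even number of times (possibly zero). The cut number $\mu(T)$ of a tangram $T$ is the least integer $k\geqslant 1$ such that $T=F_1F_2\cdots F_{k+1}$, where the $F_i$ are nonempty words satisfying $F_{\sigma(1)}\cdots F_{\sigma(j)}=F_{\sigma(j+1)}\cdots F_{\sigma(k+1)}$ for some permutation $\sigma$ of $\{1,2,\ldots,k+1\}$ and some $1\leqslant j\leqslant k$. By convention $\mu(W)=\infty$ if $W$ is not a tangram, and also if $W$ is the empty word. *)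

(* Defs.v *)
From mathcomp Require Import all_boot all_order all_algebra all_fingroup.
From mathcomp Require Import boolp constructive_ereal.
Set Implicit Arguments.
Unset Strict Implicit.
Unset Printing Implicit Defensive.

Import Order.TTheory GRing.Theory Num.Theory.

Section Words.
Variable A : finType.
Implicit Types W F D T : seq A.

(** Positions are counted from 0; only their differences are used. *)
Definition occurs_at F W i : Prop :=
  exists U V, W = U ++ F ++ V /\ size U = i.

Definition dejean (r : nat) D : Prop :=
  forall F, infix F D ->
  forall i j, occurs_at F D i -> occurs_at F D j -> i < j ->
  r.-1 * size F <= j - i.

Definition tangram W : bool := [forall a : A, ~~ odd (count_mem a W)].

(** The words F_1, ..., F_(k+1) are indexed by 'I_k.+1, so the indices of the
    left half of the rearrangement are those below j. *)
Definition cuttable T k : Prop :=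
  1 <= k /\
  exists F : 'I_k.+1 -> seq A,
    [/\ forall i, F i != [::],
        T = \big[cat/[::]]_(i < k.+1) F i
      & exists (s : {perm 'I_k.+1}) (j : nat),
          1 <= j <= k /\
          \big[cat/[::]]_(i < k.+1 | i < j) F (s i) =
          \big[cat/[::]]_(i < k.+1 | j <= i) F (s i)].

Lemma tangram_double T : tangram T -> exists X, perm_eq T (X ++ X).
Proof.
move=> /forallP tT.
exists (flatten [seq nseq (count_mem a T)./2 a | a <- enum A]).
apply/allP => a _ /=; apply/eqP.
rewrite count_cat count_flatten -map_comp sumnE big_map big_enum /=.
rewrite (bigD1 a) //= big1 => [|b ba].
  by rewrite count_nseq /= eqxx mul1n addn0 addnn even_halfK.
by rewrite count_nseq /= (negPf ba).
Qed.

(** Cutting into single letters always works, so the minimum below exists. *)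
Lemma tangram_cuttable T :
  tangram T -> T != [::] -> exists k, `[< cuttable T k >].
Proof.
move=> /tangram_double[X pX] T0.
have sT : size T = size X + size X by rewrite (perm_size pX) size_cat.
have X0 : 0 < size X by move: T0; rewrite -size_eq0 sT; case: (size X).
case eT: (size T) => [|k]; first by move: sT; rewrite eT; case: (size X) X0.
have [a0 _] : exists a : A, True by case: (X) X0 => // a; exists a.
have kE : k.+1 = size X + size X by rewrite -eT.
have sXX : size (X ++ X) == k.+1 by rewrite size_cat -kE.
have sTk : size T == k.+1 by rewrite eT.
have pXT : perm_eq (Tuple sXX) (Tuple sTk) by rewrite /= perm_sym.
have [s /= Es] := tuple_permP pXT.
exists k; apply/asboolP; split.
  by move: kE X0; case: (size X) => // n; rewrite addSn addnS => -[->].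
have catE (P : pred 'I_k.+1) (G : 'I_k.+1 -> A) :
    \big[cat/[::]]_(i | P i) [:: G i] = [seq G i | i <- enum P].
  transitivity (\big[cat/[::]]_(i <- enum P) [:: G i]); first by
    rewrite /enum_mem big_filter [index_enum _]unlock.
  by elim: (enum P) => [|x l IH]; rewrite ?big_nil ?big_cons //= IH.
exists (fun i => [:: tnth (Tuple sTk) i]); split=> //.
  rewrite catE (eq_enum (B := 'I_k.+1)) //.
  exact: (esym (map_tnth_enum (Tuple sTk))).
exists s, (size X); split.
  by rewrite X0 -ltnS kE -addn1 leq_add2l.
have XXE (P : pred 'I_k.+1) :
    \big[cat/[::]]_(i | P i) [:: tnth (Tuple sTk) (s i)] =
    [seq nth a0 (X ++ X) i | i <- [seq val i | i <- enum P]].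
  rewrite catE -map_comp; apply: eq_map => i /=.
  rewrite Es (nth_map i) ?size_enum_ord // nth_ord_enum //.
rewrite !XXE.
have lo : [seq val i | i <- enum [pred i : 'I_k.+1 | i < size X]] =
          iota 0 (size X).
  rewrite /enum_mem -enumT -(filter_map val (fun n => n < size X)).
  rewrite val_enum_ord kE iotaD filter_cat add0n.
  rewrite (eq_in_filter (a2 := predT)) ?filter_predT => [|n]; last first.
    by rewrite mem_iota => /andP[_ ->].
  rewrite (eq_in_filter (a2 := pred0)) ?filter_pred0 ?cats0 // => n.
  by rewrite mem_iota => /andP[h _]; rewrite ltnNge h.
have hi : [seq val i | i <- enum [pred i : 'I_k.+1 | size X <= i]] =
          iota (size X) (size X).
  rewrite /enum_mem -enumT -(filter_map val (fun n => size X <= n)).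
  rewrite val_enum_ord kE iotaD filter_cat add0n.
  rewrite (eq_in_filter (a2 := pred0)) ?filter_pred0 => [|n]; last first.
    by rewrite mem_iota => /andP[_ h]; rewrite leqNgt h.
  rewrite (eq_in_filter (a2 := predT)) ?filter_predT // => n.
  by rewrite mem_iota => /andP[-> _].
rewrite lo hi -{2}[size X]addn0 iotaDl -map_comp.
apply/eq_in_map => n; rewrite mem_iota => /andP[_ h] /=.
by rewrite !nth_cat h ltnNge leq_addr /= addKn.
Qed.

Definition least_cut T (h : tangram T && (T != [::])) : nat :=
  ex_minn (let: conj t n := andP h in tangram_cuttable t n).

(** Values range over the nonnegative integers together with +oo. *)
Definition cut_number T : \bar int :=
  match pselect (tangram T && (T != [::])) with
  | left h => (Posz (least_cut h))%:E
  | right _ => +oo%E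
  end.

End Words.

(* Main.v *)
(** Let |D| = 2n and let X, of length n, be the common value of the two halves
    of the rearrangement of the k + 1 pieces. Superposing the two
    factorizations of X cuts X into at most k segments. A segment of length l
    occurs in D twice, at some distance d >= (r - 1) l. The positions of D are
    thereby matched in pairs (x, y), and the sum of the |x - y| is at most the
    sum of the |z - n| over all z < 2n, which is n^2; so the sum of the l d is
    at most n^2. If k <= r - 1, the Cauchy-Schwarz inequality forces equality
    everywhere: every d is n. Then D is a square YY with |Y| = n, whereas the
    two occurrences of Y should be at distance at least (r - 1) n > n. *)

Require Import Defs.
From mathcomp Require Import all_boot all_order all_algebra.
From mathcomp Require Import constructive_ereal.
From mathcomp Require Import all_fingroup boolp zify.

Set Implicit Arguments.
Unset Strict Implicit.
Unset Printing Implicit Defensive.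

(** * Matched intervals of positions *)

Definition dist (x y : nat) : nat := (x - y) + (y - x).

(** A pair (p, l) stands for the interval of positions p, ..., p + l - 1, and a
    triple (p, q, l) for two matched intervals of length l at p and at q. *)
Definition positions (L : seq (nat * nat)) : seq nat :=
  flatten [seq iota s.1 s.2 | s <- L].

Definition left_seg (s : nat * nat * nat) : nat * nat := (s.1.1, s.2).
Definition right_seg (s : nat * nat * nat) : nat * nat := (s.1.2, s.2).

Lemma size_positions L : size (positions L) = \sum_(s <- L) s.2.
Proof.
elim: L => [|s L IH]; first by rewrite big_nil.
by rewrite big_cons -IH /positions /= size_cat size_iota.
Qed.

(** Both lists are consumed from the front, the longer head interval being cut at the length of the
    shorter. Each step uses up at least one interval and the last step uses up two, hence the
    predecessor. *)
Lemma common_refinement (L R : seq (nat * nat)) :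
  all (fun s => 0 < s.2) L -> all (fun s => 0 < s.2) R ->
  size (positions L) = size (positions R) ->
  exists S : seq (nat * nat * nat),
    [/\ positions [seq left_seg s | s <- S] = positions L,
        positions [seq right_seg s | s <- S] = positions R
      & size S <= (size L + size R).-1].
Proof.
have [m] := ubnP (size L + size R).
elim: m L R => // m IH [|[p l] L] [|[q l'] R] /= hm.
- by exists [::].
- by move=> _ /andP[/= l0 _]; rewrite /positions /= size_cat size_iota; lia.
- by move=> /andP[/= l0 _] _; rewrite /positions /= size_cat size_iota; lia.
move=> /andP[/= l0 aL] /andP[/= l0' aR].
rewrite /positions /= !size_cat !size_iota -!/(positions _) => E.
case: (ltngtP l l') => ll'.
- have [||||S [SL SR sS]] := IH L ((q + l, l' - l) :: R).
  + by rewrite /=; lia.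
  + exact: aL.
  + by rewrite /= aR; lia.
  + by rewrite /positions /= size_cat size_iota -!/(positions _); lia.
  exists ((p, q, l) :: S); split; last by move: sS => /=; lia.
    by rewrite /positions /= -/(positions _) SL.
  rewrite /positions /= -/(positions _) SR /positions /= catA -iotaD.
  by rewrite subnKC // ltnW.
- have [||||S [SL SR sS]] := IH ((p + l', l - l') :: L) R.
  + by rewrite /=; lia.
  + by rewrite /= aL; lia.
  + exact: aR.
  + by rewrite /positions /= size_cat size_iota -!/(positions _); lia.
  exists ((p, q, l') :: S); split; last by move: sS => /=; lia.
    rewrite /positions /= -/(positions _) SL /positions /= catA -iotaD.
    by rewrite subnKC // ltnW.
  by rewrite /positions /= -/(positions _) SR.
- subst l'; have [||||S [SL SR sS]] := IH L R; [lia| | |lia|] => //.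
  exists ((p, q, l) :: S); split; last by move: sS => /=; lia.
    by rewrite /positions /= -/(positions _) SL.
  by rewrite /positions /= -/(positions _) SR.
Qed.

(** * Sums of distances over a matching *)

Lemma sum_dist_center n : \sum_(x <- iota 0 (n + n)) dist x n = n * n.
Proof.
(* Both closed forms are doubled and rearranged to avoid halves and truncated subtraction. *)
have lo m : m <= n -> 2 * (\sum_(x <- iota 0 m) dist x n) + m * m = 2 * m * n + m.
  elim: m => [|m IH] hm; first by rewrite big_nil.
  rewrite -(addn1 m) iotaD big_cat big_seq1 /dist /= add0n.
  by have := IH (ltnW hm); rewrite /dist; nia.
have hi m : 2 * (\sum_(x <- iota n m) dist x n) + m = m * m.
  elim: m => [|m IH]; first by rewrite big_nil.
  rewrite -(addn1 m) iotaD big_cat big_seq1 /dist /=.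
  by move: IH; rewrite /dist; nia.
rewrite iotaD big_cat /= add0n.
by have := lo n (leqnn n); have := hi n; nia.
Qed.

(** Triangle inequality through the center [n], applied to the [l] pairs [(p + i, q + i)] of each
    triple. *)
Lemma sum_dist_matching (S : seq (nat * nat * nat)) n :
  perm_eq (positions [seq left_seg s | s <- S] ++
           positions [seq right_seg s | s <- S]) (iota 0 (n + n)) ->
  \sum_(s <- S) s.2 * dist s.1.1 s.1.2 <= n * n.
Proof.
move=> pS; rewrite -sum_dist_center -(perm_big _ pS) big_cat /=.
elim: S {pS} => [|[[p q] l] S IH]; first by rewrite big_nil.
rewrite big_cons /positions /= !big_cat -!/(positions _) /=.
suff : l * dist p q <=
    \sum_(x <- iota p l) dist x n + \sum_(x <- iota q l) dist x n by lia.
elim: l => // l IHl; rewrite -(addn1 l) !iotaD !big_cat !big_seq1 /=.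
by move: IHl; rewrite /dist; nia.
Qed.

(** Summing (K l - n)^2 >= 0 over the segments, with [dist >= K l] and the
    total bound n^2 on the sum of the l * dist, forces equality everywhere. *)
Lemma tight_matching (S : seq (nat * nat * nat)) K n :
  0 < n -> size S <= K ->
  perm_eq (positions [seq left_seg s | s <- S] ++
           positions [seq right_seg s | s <- S]) (iota 0 (n + n)) ->
  (forall s, s \in S -> K * s.2 <= dist s.1.1 s.1.2) ->
  forall s, s \in S -> dist s.1.1 s.1.2 = n.
Proof.
move=> n0 sS pS hS s sinS.
have sumd := sum_dist_matching pS.
have suml : \sum_(t <- S) t.2 = n.
  have := perm_size pS; rewrite size_cat !size_positions size_iota !big_map /=.
  lia.
(* With [m = K * t.2], this is [2 m n <= m^2 + n^2 <= m d + n^2]. *)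
have ge t : t \in S ->
    2 * n * K * t.2 <= K * (t.2 * dist t.1.1 t.1.2) + n * n.
  move=> /hS; move: (dist _ _) => d hd.
  have := leq_mul (leqnn (K * t.2)) hd; have [+ _] := nat_Cauchy (K * t.2) n.
  rewrite -!mulnn (mulnA K) -(mulnA (2 * n)).
  by move: (K * t.2) => m; nia.
(* Summed over [S], the right side of [ge] is at most [K n^2 + |S| n^2 <= 2 K n^2], which is the sum
   of the left side; so no term can be strict. *)
have eqt : 2 * n * K * s.2 = K * (s.2 * dist s.1.1 s.1.2) + n * n.
  apply/eqP; rewrite eqn_leq ge //=.
  have : \sum_(t <- rem s S) 2 * n * K * t.2 <=
      \sum_(t <- rem s S) (K * (t.2 * dist t.1.1 t.1.2) + n * n).
    by rewrite big_seq [leqRHS]big_seq; apply: leq_sum => t /mem_rem /ge.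
  have : \sum_(t <- S) (K * (t.2 * dist t.1.1 t.1.2) + n * n) <=
      \sum_(t <- S) 2 * n * K * t.2.
    rewrite big_split -!big_distrr /= suml big_const_seq count_predT iter_addn_0.
    by nia.
  by rewrite !(big_rem s sinS) /=; lia.
have := hS s sinS; move: eqt; move: (dist _ _) => d eqt hd.
have hm : (K * s.2) * (K * s.2) <= (K * s.2) * d by exact: leq_mul.
(* In other words, [(K * s.2 - n)^2 <= 0]. *)
have {hm} hm : (K * s.2) * (K * s.2) + n * n <= 2 * n * (K * s.2) by nia.
have Kl : K * s.2 = n by move: (K * s.2) hm => m hm; nia.
have : n * d = n * n by rewrite -{1}Kl; move: eqt; rewrite -Kl; nia.
by move/eqP; rewrite eqn_pmul2l // => /eqP.
Qed.

(** * Matched factors of a Dejean word *)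

Section Words.
Variables (A : finType) (a0 : A).
Implicit Types (D U V W : seq A).

Definition letters D (P : seq nat) : seq A := [seq nth a0 D i | i <- P].

Lemma letters_iota D p l :
  p + l <= size D -> letters D (iota p l) = take l (drop p D).
Proof. by move=> h; apply: map_nth_iota; lia. Qed.

Lemma occurs_at_letters D p l :
  p + l <= size D -> occurs_at (letters D (iota p l)) D p.
Proof.
move=> h; exists (take p D), (drop l (drop p D)).
by rewrite letters_iota // !cat_take_drop size_takel //; lia.
Qed.

Lemma dejean_lt r D p q l :
  dejean r D -> p < q -> q + l <= size D ->
  letters D (iota p l) = letters D (iota q l) -> r.-1 * l <= q - p.
Proof.
move=> hD pq qD E.
have op : occurs_at (letters D (iota p l)) D p by apply: occurs_at_letters; lia.
have oq : occurs_at (letters D (iota p l)) D q.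
  by rewrite E; exact: occurs_at_letters.
suff iF : infix (letters D (iota p l)) D.
  by have := hD _ iF _ _ op oq pq; rewrite size_map size_iota.
by have [U [V [DE _]]] := op; apply/infixP; exists U, V.
Qed.

Lemma dejean_dist r D p q l :
  dejean r D -> p != q -> p + l <= size D -> q + l <= size D ->
  letters D (iota p l) = letters D (iota q l) -> r.-1 * l <= dist p q.
Proof.
move=> hD; rewrite neq_ltn => /orP[] pq pD qD E.
  by have := dejean_lt hD pq qD E; rewrite /dist; lia.
by have := dejean_lt hD pq pD (esym E); rewrite /dist; lia.
Qed.

(** The two concatenations are cut at the same lengths, so they agree segment by segment. *)
Lemma letters_refinement D (S : seq (nat * nat * nat)) :
  letters D (positions [seq left_seg s | s <- S]) =
  letters D (positions [seq right_seg s | s <- S]) ->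
  forall s, s \in S ->
  letters D (iota s.1.1 s.2) = letters D (iota s.1.2 s.2).
Proof.
elim: S => [|t S IH] //=; rewrite /positions /= -!/(positions _) /letters !map_cat.
move/eqP; rewrite eqseq_cat ?size_map ?size_iota // => /andP[/eqP Et /eqP ES] s.
by rewrite inE => /predU1P[-> //|]; apply: IH.
Qed.

(** [L] and [R] model the places in [D] of the pieces of the two halves. With at most [r] pieces,
    their refinement has at most [r.-1] segments, and [tight_matching] applies with [K = r.-1]. *)
Lemma dejean_segments r D (L R : seq (nat * nat)) :
  2 < r -> dejean r D -> D != [::] ->
  all (fun s => 0 < s.2) L -> all (fun s => 0 < s.2) R ->
  perm_eq (positions L ++ positions R) (iota 0 (size D)) ->
  letters D (positions L) = letters D (positions R) ->
  r < size L + size R.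
Proof.
move=> r2 hD D0 aL aR pLR ELR; rewrite ltnNge; apply/negP => sLR.
have sE : size (positions L) = size (positions R).
  by have := congr1 size ELR; rewrite !size_map.
have [S [SL SR sS]] := common_refinement aL aR sE.
move: ELR pLR; rewrite -SL -SR => ES pS.
have {ES} ES := letters_refinement ES.
pose n := size (positions L).
have sD : size D = n + n.
  by have := perm_size pS; rewrite size_iota => <-; rewrite SL SR size_cat -sE.
have n0 : 0 < n by rewrite lt0n; apply: contraNneq D0 => n0; rewrite -size_eq0 sD n0.
have memL s i : s \in S -> i < s.2 ->
    s.1.1 + i \in positions [seq left_seg s | s <- S].
  move=> sin il; apply/flatten_mapP; exists (left_seg s); first exact: map_f.
  by rewrite mem_iota leq_addr ltn_add2l.
have memR s i : s \in S -> i < s.2 ->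
    s.1.2 + i \in positions [seq right_seg s | s <- S].
  move=> sin il; apply/flatten_mapP; exists (right_seg s); first exact: map_f.
  by rewrite mem_iota leq_addr ltn_add2l.
have bound x : (x \in positions [seq left_seg s | s <- S]) ||
               (x \in positions [seq right_seg s | s <- S]) = (x < size D).
  by rewrite -mem_cat (perm_mem pS) mem_iota.
have dS s : s \in S -> r.-1 * s.2 <= dist s.1.1 s.1.2.
  move=> sin; case: (posnP s.2) => [->|l0]; first by rewrite muln0.
  have l1 : s.2.-1 < s.2 by rewrite prednK.
  apply: dejean_dist hD _ _ _ (ES _ sin).
  (* Equal starting points would put one position on both sides of the matching. *)
  - have : uniq (positions [seq left_seg s | s <- S] ++
                 positions [seq right_seg s | s <- S]).
      by rewrite (perm_uniq pS) iota_uniq.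
    rewrite cat_uniq => /and3P[_ /hasPn disj _].
    have := disj _ (memR _ _ sin l0); rewrite !addn0 => /negP nL.
    by apply/eqP => pq; apply: nL; rewrite -pq -[s.1.1]addn0; apply: memL.
  - by have := bound (s.1.1 + s.2.-1); rewrite memL //; lia.
  - by have := bound (s.1.2 + s.2.-1); rewrite memR ?orbT //; lia.
have pS' := pS; rewrite sD in pS'.
have sS' : size S <= r.-1 by lia.
have tight := tight_matching n0 sS' pS' dS.
(* Every matched pair is at distance n, so D is a square. *)
have sq : letters D (iota 0 n) = letters D (iota n n).
  have -> : iota n n = [seq n + i | i <- iota 0 n] by rewrite -iotaDl addn0.
  rewrite /letters -map_comp.
  apply/eq_in_map => z; rewrite mem_iota add0n => /= zn.
  have nthS s i : s \in S -> i < s.2 -> nth a0 D (s.1.1 + i) = nth a0 D (s.1.2 + i).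
    move=> /ES E il; have := congr1 (fun w => nth a0 w i) E.
    by rewrite /letters !(nth_map 0) ?size_iota // !nth_iota.
  have : z < size D by rewrite sD; lia.
  (* Whichever side [z] lies on, its partner is at distance [n]; as [z < n], the partner is
     [n + z]. *)
  rewrite -bound => /orP[] /flatten_mapP[_ /mapP[[[p q] l] sin ->]];
    rewrite mem_iota /= => /andP[z1 z2]; have := tight _ sin; rewrite /dist /= => ds.
  - have il : z - p < l by lia.
    have := nthS _ _ sin il; rewrite /= (subnKC z1) => -> /=.
    by congr (nth a0 D _); lia.
  - have il : z - q < l by lia.
    have := nthS _ _ sin il; rewrite /= (subnKC z1) => <- /=.
    by congr (nth a0 D _); lia.
have nD : n + n <= size D by rewrite sD.
have := dejean_lt hD n0 nD sq; rewrite subn0.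
by case: (r) r2 => [|[|[|r']]] //= _; nia.
Qed.

(** * From a cut to intervals of positions *)

Lemma cat_iota_offsets (f : nat -> nat) m :
  \big[cat/[::]]_(i < m) iota (\sum_(h < i) f h) (f i) =
  iota 0 (\sum_(i < m) f i).
Proof.
elim: m => [|m IH]; first by rewrite !big_ord0.
by rewrite !big_ord_recr /= IH iotaD add0n.
Qed.

Lemma size_bigcat I (s : seq I) P (F : I -> seq A) :
  size (\big[cat/[::]]_(i <- s | P i) F i) = \sum_(i <- s | P i) size (F i).
Proof. by apply: (big_morph size) => // u v; rewrite size_cat. Qed.

Lemma letters_offset (f : nat -> seq A) m i : i < m ->
  letters (\big[cat/[::]]_(h < m) f h)
    (iota (\sum_(h < i) size (f h)) (size (f i))) = f i.
Proof.
move=> im; rewrite -(big_mkord xpredT (fun h => size (f h))) -(big_mkord xpredT f).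
rewrite (@big_cat_nat _ _ _ i) ?(ltnW im) //= (@big_ltn _ _ _ i) //=.
rewrite letters_iota ?size_cat ?size_bigcat; last lia.
by rewrite drop_size_cat ?size_bigcat // take_size_cat.
Qed.

Lemma positions_big I (s : seq I) (P : pred I) (g : I -> nat * nat) :
  positions [seq g i | i <- s & P i] = \big[cat/[::]]_(i <- s | P i) iota (g i).1 (g i).2.
Proof.
elim: s => [|i s IH]; first by rewrite big_nil.
by rewrite big_cons /=; case: (P i) => //=; rewrite -IH.
Qed.

(** Concatenation is not commutative, but counting turns it into a sum, which can be reindexed by
    [s] and split along [P]. *)
Lemma perm_bigcat_predC (I : finType) (P : pred I) (G : I -> seq nat) (s : {perm I}) :
  perm_eq ((\big[cat/[::]]_(i | P i) G (s i)) ++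
           (\big[cat/[::]]_(i | ~~ P i) G (s i))) (\big[cat/[::]]_i G i).
Proof.
have cE J (r : seq J) (Q : pred J) (H : J -> seq nat) a :
    count a (\big[cat/[::]]_(i <- r | Q i) H i) = \sum_(i <- r | Q i) count a (H i).
  by apply: (big_morph (count a)) => // u v; rewrite count_cat.
apply/seq.permP => a; rewrite count_cat !cE.
by rewrite [RHS](reindex_inj (@perm_inj _ s)) [RHS](bigID P).
Qed.

Lemma dejean_cuttable r D k : 2 < r -> dejean r D -> cuttable D k -> r <= k.
Proof.
move=> r2 hD [k0 [F [F0 DE [s [j [jk]]]]]].
(* Indexing by [nat] lets offsets be partial sums over [h < i]. *)
pose f m := F (inord m); have fE (i : 'I_k.+1) : F i = f i by rewrite /f inord_val.
pose off i := \sum_(h < i) size (f h).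
have Df : D = \big[cat/[::]]_(i < k.+1) f i.
  by rewrite DE; apply: eq_bigr => i _; rewrite fE.
pose g (i : 'I_k.+1) := (off (s i), size (f (s i))).
pose I := index_enum 'I_k.+1.
pose L := [seq g i | i <- I & (i : 'I_k.+1) < j].
pose R := [seq g i | i <- I & ~~ ((i : 'I_k.+1) < j)].
have lE (P : pred 'I_k.+1) :
    letters D (positions [seq g i | i <- I & P i]) =
    \big[cat/[::]]_(i < k.+1 | P i) F (s i).
  rewrite positions_big (big_morph (letters D) (@map_cat _ _ _) (erefl _)).
  by apply: eq_bigr => i _; rewrite Df letters_offset // fE.
have gpos (i : 'I_k.+1) : 0 < (g i).2 by rewrite /g /= -fE lt0n size_eq0.
have aL : all (fun t => 0 < t.2) L by apply/allP => _ /mapP[i _ ->].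
have aR : all (fun t => 0 < t.2) R by apply/allP => _ /mapP[i _ ->].
have sLR : size L + size R = k.+1.
  by rewrite !size_map !size_filter count_predC -[RHS]card_ord cardT enumT.
move=> E; rewrite -ltnS -sLR; apply: dejean_segments r2 hD _ aL aR _ _.
- rewrite -size_eq0 DE size_bigcat big_ord_recl -lt0n addn_gt0 lt0n.
  by rewrite size_eq0 F0.
- rewrite !positions_big Df size_bigcat -(cat_iota_offsets (fun h => size (f h))).
  exact: (perm_bigcat_predC (fun i : 'I_k.+1 => i < j)
           (fun i : 'I_k.+1 => iota (off i) (size (f i)))).
- by rewrite !lE E; apply: eq_bigl => i; rewrite leqNgt.
Qed.

End Words.

Theorem theorem4 (r : nat) (A : finType) (D : seq A)
  (hr : (5 <= r)%N) (hA : #|A| = r) (hD : dejean r D) :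
  ((Posz r)%:E <= cut_number D)%E.
Proof.
rewrite /cut_number; case: pselect => [h|_]; last by rewrite leey.
rewrite lee_fin lez_nat /least_cut; case: ex_minnP => k /asboolP kD _.
(* The first letter of [D] serves as the default letter of [letters]. *)
have /andP[_] := h; case: D hD h kD => // a D hD h kD _.
exact: (dejean_cuttable a (leq_trans _ hr) hD kD).
Qed.
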